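(* Let $d\ge1$ and $k\ge2$ be integers. The map $(\mathbf{A},s)\mapsto M(\mathbf{A},s)\in[-\infty,\infty)$ is continuous on $\mathcal{A}_{d,k}\times(0,\infty)$.
   Context: $\mathcal{A}_{d,k}$ is the set of $k$-tuples $\mathbf{A}=(A_1,\ldots,A_k)$ of real $d\times d$ matrices with its usual topology, and $\|\cdot\|$ is the Euclidean operator norm. For $\mathbf{A}\in\mathcal{A}_{d,k}$ and $s>0$, $$M(\mathbf{A},s)=\lim_{n\to\infty}\frac1n\log\Big(\sum_{|\mathbf{i}|=n}\|A_{\mathbf{i}}\|^s\Big),$$ where the sum is over all words $\mathbf{i}=i_1\cdots i_n$ over $\{1,\ldots,k\}$ and $A_{\mathbf{i}}=A_{i_1}\cdots A_{i_n}$. The limit exists by sub-additivity and may equal $-\infty$; $[-\infty,\infty)$ carries its usual topology. *)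

(* Defs.v *)
From mathcomp Require Import all_boot all_order all_algebra.
From mathcomp Require Import all_classical all_reals all_analysis.

Set Implicit Arguments.
Unset Strict Implicit.
Unset Printing Implicit Defensive.

Import Order.TTheory GRing.Theory Num.Theory.
Import numFieldNormedType.Exports.

Local Open Scope classical_set_scope.
Local Open Scope ring_scope.

Definition enorm (R : realType) (d : nat) (x : 'cV[R]_d) : R :=
  Num.sqrt (\sum_(i < d) x i 0 ^+ 2).

(* The library norm on matrices is the entrywise maximum, not this one. *)
Definition opnorm (R : realType) (d : nat) (B : 'M[R]_d) : R :=
  sup [set enorm (B *m x) | x in [set x : 'cV[R]_d | enorm x <= 1]].

(* k-tuples of d x d matrices, with the product topology; the topology on
   'M[R]_d is the entrywise one, so this is the usual topology of R^(k d^2). *)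
Notation mxtuple R d k := {ptws 'I_k -> 'M[R]_d}.

Definition word_mx (R : realType) (d k : nat) (A : mxtuple R d k)
  (w : seq 'I_k) : 'M[R]_d := \prod_(i <- w) A i.

Definition word_sum (R : realType) (d k : nat) (A : mxtuple R d k) (s : R)
  (n : nat) : R := \sum_(w : n.-tuple 'I_k) opnorm (word_mx A w) `^ s.

(* The extended logarithm lne satisfies lne 0 = -oo, so this sequence takes
   the value -oo as soon as all products of length n vanish.  The term n = 0
   is 0^-1 * lne _ with 0^-1 = 0, and is irrelevant for the limit. *)
Definition pressure_seq (R : realType) (d k : nat) (A : mxtuple R d k) (s : R)
  (n : nat) : \bar R := ((n%:R^-1)%:E * lne (word_sum A s n)%:E)%E.

Definition pressure (R : realType) (d k : nat) (A : mxtuple R d k) (s : R) :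
  \bar R := lim (pressure_seq A s @ \oo).

(* Main.v *)
Require Import Defs.
From mathcomp Require Import all_boot all_order all_algebra.
From mathcomp Require Import all_classical all_reals all_analysis.
From mathcomp Require Import ring lra.
Import Order.TTheory GRing.Theory Num.Theory.
Import numFieldNormedType.Exports.
Local Open Scope classical_set_scope.
Local Open Scope ring_scope.
Set Implicit Arguments.
Unset Strict Implicit.

(** The pressure is the logarithm of the growth rate [rho(A, s)] of the sums
    [t_n = \sum_(|w| = n) |A_w|^s].  These sums are submultiplicative, so
    [rho = inf_n t_n^(1/n)] is an infimum of continuous functions, and upper
    semicontinuity is immediate (as is continuity wherever [rho = 0]).  Lower
    semicontinuity comes from a lower bound for [rho] by finitely many terms:
    there is a constant [C(s)], depending only on [d] and [s], with
<<
      t_(d n) <= C(s) * rho^n * t_n^(d - 1)    for all n >= 1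
>>
    (in the code, with any [eta > rho] in place of [rho]).  Since [t_n] behaves
    like [rho^n], at a given point this loses only a factor subexponential in
    [n]; for a fixed large [n] it involves only continuous functions of [(A, s)]
    besides [rho], so [rho] cannot drop at nearby points.  This is the deduction
    made in [growth_continuous].

    For a finite list [L] of matrices, the inequality for [n = 1]
    ([wsum_dim_le_rate]) is proved as follows; the general case applies it to
    the list of all products of length [n].  Let now [rho > 0] and [N >= 1] be
    any numbers with [\sum_(B in L^N) |B|^s <= rho^N].  The weight
<<
      f(x) = \sum_(j < N) rho^-j \sum_(B in L^j) |B x|^s
>>
    is homogeneous of degree [s], satisfies the triangle inequality up to the
    factor [2^s], and contracts: [\sum_(A in L) f(A x) <= rho f(x)]
    ([orbit_weight_contract]).  There is a basis [P_p] of controlled distortion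
    whose coordinates [Q_p] satisfy [|Q_p y|^s f(P_p) <= c f(y)]
    ([adapted_coordinates]); it plays the role of a John ellipsoid for [f], but
    is obtained by a pivoting argument.  In this basis the entries of the
    matrices satisfy
    [\sum_A |a_pr|^s <= c rho] as soon as [f(P_r) <= f(P_p)], and otherwise are
    controlled only by the norms.  An entry of a product of [d] matrices is a
    sum over paths of length [d] in a set of [d] indices, along which [f(P_p)]
    cannot increase strictly at every step: each path has a step contributing a
    factor [c rho], and the [d - 1] other steps contribute norms
    ([wsum_dim_le]). *)

(** * Powers of sums *)

Section RealPowers.
Context {R : realType}.
Implicit Types (x y s : R).

Lemma ler_powR_base s x y : 0 <= s -> 0 <= x -> x <= y -> x `^ s <= y `^ s.
Proof.
move=> s0 x0 xy; apply: (ge0_ler_powR s0) => //.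
by rewrite nnegrE (le_trans x0).
Qed.

(** Each [x i] is at most the [s]-th root of [\sum_i x i `^ s].  This crude
    argument covers concave and convex powers alike, and its constant depends
    continuously on [s]. *)
Lemma powR_sum_le (I : finType) (x : I -> R) s : 0 < s ->
  (forall i, 0 <= x i) ->
  (\sum_i x i) `^ s <= #|I|%:R `^ s * \sum_i x i `^ s.
Proof.
move=> s0 x0; set Z := \sum_i x i `^ s.
have Z0 : 0 <= Z by apply: sumr_ge0 => i _; exact: powR_ge0.
have xZ i : x i <= Z `^ s^-1.
  rewrite -[leLHS]powRr1// -(@mulfV _ s) ?gt_eqF// powRrM.
  apply: ler_powR_base; rewrite ?powR_ge0//; first by rewrite invr_ge0 ltW.
  by rewrite /Z (bigD1 i)//= lerDl sumr_ge0// => j _; exact: powR_ge0.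
have /(ler_powR_base (ltW s0)) : \sum_i x i <= #|I|%:R * Z `^ s^-1.
  apply: (le_trans (ler_sum _ (fun i _ => xZ i))).
  by rewrite sumr_const mulr_natl.
move=> /(_ (sumr_ge0 _ (fun i _ => x0 i))) /le_trans; apply.
by rewrite powRM ?powR_ge0// -powRrM mulVf ?gt_eqF// powRr1.
Qed.

Lemma powRD_le x y s : 0 < s -> 0 <= x -> 0 <= y ->
  (x + y) `^ s <= 2 `^ s * (x `^ s + y `^ s).
Proof.
move=> s0 x0 y0.
have := @powR_sum_le bool (fun b => if b then x else y) s s0.
by rewrite !big_bool card_bool; apply=> -[].
Qed.

End RealPowers.

(** * The entrywise l1 norm *)

Section L1norm.
Context {R : realType}.

(** Submultiplicative for all matrix sizes, including matrices acting on
    vectors, and visibly continuous, which makes it handier than the operator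
    norm; the two differ by bounded factors, invisible to the growth rate. *)
Definition l1norm m n (B : 'M[R]_(m, n)) : R := \sum_i \sum_j `|B i j|.

Lemma l1norm_ge0 m n (B : 'M[R]_(m, n)) : 0 <= l1norm B.
Proof. by apply: sumr_ge0 => i _; apply: sumr_ge0. Qed.

Lemma l1norm_row_ge m n (B : 'M[R]_(m, n)) i : \sum_j `|B i j| <= l1norm B.
Proof.
by rewrite /l1norm (bigD1 i)//= lerDl sumr_ge0// => *; exact: sumr_ge0.
Qed.

Lemma l1norm_entry_ge m n (B : 'M[R]_(m, n)) i j : `|B i j| <= l1norm B.
Proof.
apply: le_trans (l1norm_row_ge B i).
by rewrite (bigD1 j)//= lerDl sumr_ge0.
Qed.

Lemma l1normD m n (A B : 'M[R]_(m, n)) : l1norm (A + B) <= l1norm A + l1norm B.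
Proof.
rewrite /l1norm -big_split/=; apply: ler_sum => i _.
rewrite -big_split/=; apply: ler_sum => j _.
by rewrite mxE ler_normD.
Qed.

Lemma l1normZ m n c (A : 'M[R]_(m, n)) : l1norm (c *: A) = `|c| * l1norm A.
Proof.
rewrite /l1norm mulr_sumr; apply: eq_bigr => i _.
by rewrite mulr_sumr; apply: eq_bigr => j _; rewrite mxE normrM.
Qed.

Lemma l1normM m n p (A : 'M[R]_(m, n)) (B : 'M[R]_(n, p)) :
  l1norm (A *m B) <= l1norm A * l1norm B.
Proof.
rewrite {1 2}/l1norm mulr_suml; apply: ler_sum => i _.
apply: (@le_trans _ _ (\sum_k \sum_j `|A i j| * `|B j k|)).
  apply: ler_sum => k _; rewrite mxE.
  apply: le_trans (ler_norm_sum _ _ _) _.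
  by apply: ler_sum => j _; rewrite normrM.
rewrite exchange_big mulr_suml; apply: ler_sum => j _ /=.
by rewrite -mulr_sumr ler_wpM2l// l1norm_row_ge.
Qed.

End L1norm.

(** * Sums over products of matrices *)

Section ProductFamilies.
Context {R : realType} {d : nat}.
Implicit Types (L : seq 'M[R]_d) (s : R).

(** Finite families are lists, so that the products of length [n] of a family
    form a family of the same kind, to which the inequality for single matrices
    applies again; words over words need no reindexing. *)
Fixpoint products L n : seq 'M[R]_d :=
  if n is m.+1 then [seq A *m B | A <- L, B <- products L m] else [:: 1%:M].

Lemma sum_products0 L (phi : 'M[R]_d -> R) :
  \sum_(B <- products L 0) phi B = phi 1%:M.
Proof. by rewrite big_seq1. Qed.

Lemma sum_productsS L n (phi : 'M[R]_d -> R) :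
  \sum_(B <- products L n.+1) phi B =
  \sum_(A <- L) \sum_(B <- products L n) phi (A *m B).
Proof. by rewrite big_allpairs_dep. Qed.

Lemma sum_products1 L (phi : 'M[R]_d -> R) :
  \sum_(B <- products L 1) phi B = \sum_(A <- L) phi A.
Proof.
rewrite sum_productsS; apply: eq_bigr => A _.
by rewrite sum_products0 mulmx1.
Qed.

Lemma sum_productsD L m n (phi : 'M[R]_d -> R) :
  \sum_(B <- products L (m + n)) phi B =
  \sum_(A <- products L m) \sum_(B <- products L n) phi (A *m B).
Proof.
elim: m phi => [|m IH] phi.
  by rewrite sum_products0; under [RHS]eq_bigr do rewrite mul1mx.
rewrite addSn !sum_productsS; apply: eq_bigr => A _.
rewrite IH; apply: eq_bigr => A' _.
by apply: eq_bigr => B _; rewrite mulmxA.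
Qed.

Lemma sum_productsM L m n (phi : 'M[R]_d -> R) :
  \sum_(B <- products (products L n) m) phi B =
  \sum_(B <- products L (m * n)) phi B.
Proof.
elim: m phi => [|m IH] phi; first by rewrite mul0n !sum_products0.
rewrite sum_productsS mulSn sum_productsD.
by apply: eq_bigr => A _; rewrite IH.
Qed.

Definition wsum s L n : R := \sum_(B <- products L n) l1norm B `^ s.

Lemma wsum_ge0 s L n : 0 <= wsum s L n.
Proof. by apply: sumr_ge0 => B _; exact: powR_ge0. Qed.

Lemma wsumM s L m n : wsum s (products L n) m = wsum s L (m * n).
Proof. exact: sum_productsM. Qed.

Lemma wsumD_le s L m n : 0 <= s ->
  wsum s L (m + n) <= wsum s L m * wsum s L n.
Proof.
move=> s0; rewrite /wsum sum_productsD mulr_suml.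
apply: ler_sum => A _; rewrite mulr_sumr; apply: ler_sum => B _.
rewrite -powRM ?l1norm_ge0//.
exact: ler_powR_base s0 (l1norm_ge0 _) (l1normM _ _).
Qed.

End ProductFamilies.

(** * Coordinates adapted to a homogeneous weight *)

Section AdaptedCoordinates.
Context {R : realType} {d : nat}.
Variables (s q : R) (f : 'cV[R]_d -> R).
Hypotheses (s_gt0 : 0 < s) (q_ge1 : 1 <= q).
Implicit Types (J : {set 'I_d}) (x y : 'cV[R]_d).
Hypothesis fD : forall x y, f (x + y) <= q * (f x + f y).
Hypothesis fZ : forall c x, f (c *: x) = `|c| `^ s * f x.
Hypothesis f_ge : forall x j, `|x j 0| `^ s <= f x.

Definition supported J x := forall j, j \notin J -> x j 0 = 0.

(** The pivot of one elimination step: among the vectors supported on [J] with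
    an entry 1 and no entry of larger absolute value, [u] minimises [f] up to a
    factor 2.  An exact minimiser would require continuity and compactness.  By
    homogeneity the minimality bounds [f] from below at every vector supported
    on [J]. *)
Lemma almost_minimal_vector J : J != finset.set0 -> exists u r,
  [/\ supported J u, r \in J, u r 0 = 1, forall j, `|u j 0| <= 1 &
      forall y, supported J y -> forall j, `|y j 0| `^ s * f u <= 2 * f y].
Proof.
move=> /set0Pn[r0 r0J].
pose good u r := [/\ supported J u, r \in J, u r 0 = 1 & forall j, `|u j 0| <= 1].
pose X := [set v | exists u r, good u r /\ v = f u]%classic.
(* so [inf X] is positive and some element of [X] is less than [2 * inf X] *)
have X1 v : X v -> 1 <= v.
  move=> [u [r [[_ _ ur _] ->]]].
  by apply: le_trans (f_ge u r); rewrite ur normr1 powR1.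
have Xinf : has_inf X.
  split; last by exists 1 => v /X1.
  exists (f (delta_mx r0 0)), (delta_mx r0 0), r0; split=> //; split=> //.
  - by move=> j jJ; rewrite mxE eqxx andbT; case: eqP jJ => // ->; rewrite r0J.
  - by rewrite mxE !eqxx.
  - move=> j; rewrite mxE; case: andb; by rewrite ?normr1 ?normr0.
have inf1 : 1 <= inf X by apply: lb_le_inf (proj1 Xinf) _ => v /X1.
have inf_gt0 : 0 < inf X by apply: lt_le_trans inf1.
have [_ [u [r [[uJ rJ ur u1] ->]]] fu] := inf_adherent inf_gt0 Xinf.
exists u, r; split=> // y yJ j.
pose t := [arg max_(i > r0 in J) `|y i 0|]%O.
have [tJ tmax] : t \in J /\ forall i, i \in J -> `|y i 0| <= `|y t 0|.
  by rewrite /t; case: arg_maxP.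
have {}tmax i : `|y i 0| <= `|y t 0|.
  by have [/tmax//|/yJ->] := boolP (i \in J); rewrite normr0.
have yjt : `|y j 0| `^ s <= `|y t 0| `^ s.
  by apply: ler_powR_base => //; exact: ltW.
have fy0 : 0 <= f y by apply: le_trans (f_ge y j); exact: powR_ge0.
have [yt0|yt0] := eqVneq (y t 0) 0.
  move: (tmax j); rewrite yt0 normr0 normr_le0 => /eqP ->.
  by rewrite normr0 powR0 ?gt_eqF// mul0r mulr_ge0.
have infw : inf X <= f ((y t 0)^-1 *: y).
  apply: ge_inf; first by case: Xinf.
  exists ((y t 0)^-1 *: y), t; split=> //; split=> //.
  - by move=> i /yJ yi; rewrite mxE yi mulr0.
  - by rewrite mxE mulVf.
  - move=> i; rewrite mxE normrM normfV mulrC ler_pdivrMr ?normr_gt0// mul1r.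
    exact: tmax.
have -> : f y = `|y t 0| `^ s * f ((y t 0)^-1 *: y).
  by rewrite -fZ scalerA mulfV// scale1r.
rewrite mulrCA; apply: ler_pM; rewrite ?powR_ge0//.
  by apply: le_trans (f_ge u r); exact: powR_ge0.
by move: infw fu; lra.
Qed.

(** [P] is a basis of the vectors supported on [J] and [Q] its dual basis.  The
    bounds on the entries of [P p] and on the values of [Q p] control the
    distortion of the change of coordinates; the last clause says that the basis
    is almost orthogonal for [f], and [1 <= f (P p)] allows dividing by
    [f (P p)]. *)
Definition adapted J (P : 'I_d -> 'cV[R]_d) (Q : 'I_d -> 'rV[R]_d) :=
  [/\ forall p, p \in J -> supported J (P p),
      forall p, p \in J -> (forall j, `|P p j 0| <= 1) /\ 1 <= f (P p),
      forall y, supported J y -> y = \sum_(p in J) (Q p *m y) 0 0 *: P p,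
      forall y (M : R) p, p \in J -> (forall j, `|y j 0| <= M) ->
        `|(Q p *m y) 0 0| <= 2 ^+ #|J| * M &
      forall y p, p \in J -> supported J y ->
        `|(Q p *m y) 0 0| `^ s * f (P p) <= (3 * q) ^+ #|J| * f y].

(** Gaussian elimination with pivots minimising [f].  Take the pivot [u] with
    [u_r = 1] as one basis vector, with coordinate [y_r], and recurse on the
    remaining part [y - y_r u], which is supported on [J :\ r].  Almost
    minimality gives [|y_r|^s f(u) <= 2 f(y)], hence
    [f(y - y_r u) <= q (f(y) + |y_r|^s f(u)) <= 3 q f(y)]: each step costs a
    factor [3 q] for [f], and a factor 2 for the entries because
    [|u_j| <= 1]. *)
Lemma adapted_coordinates_on J : exists P Q, adapted J P Q.
Proof.
have [n] := ubnP #|J|; elim: n J => // n IH J Jn.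
have [->|J0] := eqVneq J finset.set0.
  have no p : (p \in finset.set0) -> False by rewrite finset.in_set0.
  exists (fun=> 0), (fun=> 0); split.
  - by move=> p /no.
  - by move=> p /no.
  - move=> y y0; rewrite big_pred0 => [|p]; last by rewrite finset.in_set0.
    by apply/colP => j; rewrite mxE y0// finset.in_set0.
  - by move=> y M p /no.
  - by move=> y p /no.
have [u [r [uJ rJ ur u1 umin]]] := almost_minimal_vector J0.
have cJ : #|J| = #|J :\ r|.+1 by rewrite (cardsD1 r) rJ.
have [|P [Q [PJ P1 PQ Qb Qf]]] := IH (J :\ r)%SET.
  by move: Jn; rewrite cJ ltnS.
pose red y := y - y r 0 *: u.
have redJ y : supported J y -> supported (J :\ r)%SET (red y).
  move=> yJ j; rewrite finset.in_setD1 negb_and negbK !mxE => /orP[/eqP->|jJ].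
    by rewrite ur mulr1 subrr.
  by rewrite (yJ _ jJ) (uJ _ jJ) mulr0 subrr.
pose P' p := if p == r then u else P p.
pose Q' p : 'rV[R]_d := if p == r then delta_mx 0 r
                        else Q p - (Q p *m u) 0 0 *: delta_mx 0 r.
have P'r : P' r = u by rewrite /P' eqxx.
have Q'r y : (Q' r *m y) 0 0 = y r 0.
  by rewrite /Q' eqxx -rowE mxE.
have Q'p p y : p != r -> (Q' p *m y) 0 0 = (Q p *m red y) 0 0.
  move=> /negPf pr; rewrite /Q' pr mulmxBl -scalemxAl -rowE.
  by rewrite mulmxBr -scalemxAr !mxE [in RHS]mulrC.
have f0 y : 0 <= f y by apply: le_trans (f_ge y r); exact: powR_ge0.
have q3 : 1 <= 3 * q by move: q_ge1; lra.
have q30 : 0 <= (3 * q) ^+ #|(J :\ r)%SET| by rewrite exprn_ge0// (le_trans _ q3).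
have q31 : 1 <= (3 * q) ^+ #|(J :\ r)%SET| by rewrite exprn_ege1.
exists P', Q'; split.
- move=> p pJ; rewrite /P'; case: eqVneq => [_//|pr] j jJ.
  by rewrite PJ// !finset.inE ?pr// negb_and jJ orbT.
- move=> p pJ; rewrite /P'; case: eqVneq => [_|pr].
    by split=> //; apply: le_trans (f_ge u r); rewrite ur normr1 powR1.
  by apply: P1; rewrite !finset.inE pr.
- move=> y yJ; rewrite (bigD1 r)//= Q'r P'r.
  rewrite -[LHS](subrK (y r 0 *: u)) addrC; congr (_ + _).
  rewrite [LHS](PQ _ (redJ _ yJ)); apply: eq_big => p.
    by rewrite finset.in_setD1 andbC.
  by rewrite finset.in_setD1 => /andP[pr pJ]; rewrite Q'p// /P' (negPf pr).
- move=> y M p pJ yM.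
  have M0 : 0 <= M by apply: le_trans (yM r).
  have [->|pr] := eqVneq p r.
    rewrite Q'r (le_trans (yM r))// ler_peMl// exprn_ege1//; lra.
  rewrite Q'p// cJ exprSr -mulrA; apply: Qb; first by rewrite !finset.inE pr.
  move=> j; rewrite !mxE mulrDl mul1r (le_trans (ler_normB _ _))// lerD//.
  by rewrite normrM (le_trans _ (yM r))// ler_piMr.
- move=> y p pJ yJ; rewrite cJ.
  have yu := umin y yJ r.
  have [->|pr] := eqVneq p r.
    rewrite Q'r P'r (le_trans yu)// ler_wpM2r//.
    rewrite exprS; apply: (@le_trans _ _ (3 * q)); first by move: q_ge1; lra.
    by rewrite ler_peMr// (le_trans _ q3).
  rewrite Q'p// /P' (negPf pr).
  apply: le_trans (Qf _ p _ (redJ _ yJ)) _; first by rewrite !finset.inE pr.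
  rewrite exprSr -mulrA ler_wpM2l//.
  have := fD y (- y r 0 *: u); rewrite fZ normrN -/(red y) scaleNr => h.
  apply: (le_trans h); rewrite [3 * q]mulrC -mulrA ler_wpM2l ?(le_trans _ q_ge1)//.
  by move: yu; lra.
Qed.

Lemma adapted_coordinates : exists P Q, adapted [set: 'I_d]%SET P Q.
Proof. exact: adapted_coordinates_on. Qed.

End AdaptedCoordinates.

(** * A weight contracted by a family of matrices *)

Section OrbitWeight.
Context {R : realType} {d : nat}.
Variables (s rho : R) (L : seq 'M[R]_d) (n : nat).
Hypotheses (s_gt0 : 0 < s) (rho_gt0 : 0 < rho) (n_gt0 : (0 < n)%N).
Implicit Types (x y : 'cV[R]_d).

Definition orbit_sum j x : R := \sum_(B <- products L j) l1norm (B *m x) `^ s.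

(** A truncated Lyapunov function: the sum over all [j] has the same contraction
    property when it converges.  Truncation at [n] costs nothing when the sum
    over products of length [n] is at most [rho ^+ n]. *)
Definition orbit_weight x : R := \sum_(j < n) rho ^- j * orbit_sum j x.

Lemma orbit_sum_ge0 j x : 0 <= orbit_sum j x.
Proof. by apply: sumr_ge0 => B _; exact: powR_ge0. Qed.

Lemma orbit_weightD x y :
  orbit_weight (x + y) <= 2 `^ s * (orbit_weight x + orbit_weight y).
Proof.
rewrite -big_split/= mulr_sumr; apply: ler_sum => j _.
rewrite -mulrDr mulrCA ler_wpM2l ?invr_ge0 ?exprn_ge0 ?(ltW rho_gt0)//.
rewrite -big_split/= mulr_sumr; apply: ler_sum => B _.
rewrite mulmxDr; apply: le_trans (powRD_le s_gt0 (l1norm_ge0 _) (l1norm_ge0 _)).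
by apply: ler_powR_base (ltW s_gt0) (l1norm_ge0 _) (l1normD _ _).
Qed.

Lemma orbit_weightZ c x : orbit_weight (c *: x) = `|c| `^ s * orbit_weight x.
Proof.
rewrite mulr_sumr; apply: eq_bigr => j _; rewrite mulrCA; congr (_ * _).
rewrite mulr_sumr; apply: eq_bigr => B _.
by rewrite -scalemxAr l1normZ powRM ?l1norm_ge0.
Qed.

Lemma orbit_weight_ge x i : `|x i 0| `^ s <= orbit_weight x.
Proof.
rewrite /orbit_weight (bigD1 (Ordinal n_gt0))//= expr0 invr1 mul1r.
rewrite /orbit_sum sum_products0 mul1mx.
apply: (@le_trans _ _ (l1norm x `^ s)).
  by apply: ler_powR_base (ltW s_gt0) _ (l1norm_entry_ge _ _ _).
rewrite lerDl; apply: sumr_ge0 => j _.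
by rewrite mulr_ge0 ?orbit_sum_ge0// invr_ge0 exprn_ge0// ltW.
Qed.

(** Applying the family shifts the index [j] by one, which gives the factor
    [rho]; the term of index [n] that enters is at most [l1norm x `^ s], the
    term of index 0 that leaves. *)
Lemma orbit_weight_contract x : wsum s L n <= rho ^+ n ->
  \sum_(A <- L) orbit_weight (A *m x) <= rho * orbit_weight x.
Proof.
move=> Ln; rewrite /orbit_weight exchange_big/=.
have shift j : \sum_(A <- L) orbit_sum j (A *m x) = orbit_sum j.+1 x.
  rewrite /orbit_sum -[j.+1]addn1 sum_productsD exchange_big/=.
  apply: eq_bigr => B _; rewrite sum_products1.
  by apply: eq_bigr => A _; rewrite mulmxA.
under eq_bigr do rewrite -mulr_sumr shift.
have -> : \sum_(j < n) rho ^- j * orbit_sum j.+1 x =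
    rho * \sum_(j < n) rho ^- j.+1 * orbit_sum j.+1 x.
  rewrite mulr_sumr; apply: eq_bigr => j _; rewrite mulrA; congr (_ * _).
  by rewrite exprS invfM mulrA mulfV ?mul1r// gt_eqF.
rewrite ler_pM2l// -(lerD2l (rho ^- 0 * orbit_sum 0 x)).
have := big_ord_recl n (fun j : 'I_n.+1 => rho ^- j * orbit_sum j x) (op := +%R).
move=> /= <-; rewrite big_ord_recr/= addrC lerD2r.
rewrite expr0 invr1 mul1r mulrC ler_pdivrMr ?exprn_gt0//.
rewrite /orbit_sum sum_products0 mul1mx mulrC.
apply: le_trans (ler_wpM2r (powR_ge0 _ _) Ln).
rewrite mulr_suml; apply: ler_sum => B _.
rewrite -powRM ?l1norm_ge0//.
exact: ler_powR_base (ltW s_gt0) (l1norm_ge0 _) (l1normM _ _).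
Qed.

End OrbitWeight.

(** * Products of as many matrices as the dimension *)

Section ProductBound.
Context {R : realType} {d : nat}.
Variables (s q rho : R) (L : seq 'M[R]_d) (f : 'cV[R]_d -> R).
Variables (P : 'I_d -> 'cV[R]_d) (Q : 'I_d -> 'rV[R]_d).
Hypotheses (s_gt0 : 0 < s) (q_ge1 : 1 <= q) (rho_gt0 : 0 < rho).
Hypothesis PQ : adapted s q f [set: 'I_d]%SET P Q.
Hypothesis f_contract : forall x, \sum_(A <- L) f (A *m x) <= rho * f x.

(** The matrix of [B] in the basis [P]. *)
Let coef (B : 'M[R]_d) p r : R := (Q p *m (B *m P r)) 0 0.

Let E n p r := \sum_(B <- products L n) `|coef B p r| `^ s.

Let expand y : y = \sum_p (Q p *m y) 0 0 *: P p.
Proof.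
have [_ _ h _ _] := PQ; rewrite [LHS]h; last by move=> j; rewrite finset.in_setT.
by apply: eq_bigl => p; rewrite finset.in_setT.
Qed.

Let Q_le (y : 'cV[R]_d) M p : (forall j, `|y j 0| <= M) -> `|(Q p *m y) 0 0| <= 2 ^+ d * M.
Proof.
by have [_ _ _ h _] := PQ; move=> /h; rewrite cardsT card_ord; apply; rewrite finset.in_setT.
Qed.

Let P_le p j : `|P p j 0| <= 1.
Proof. by have [_ h _ _ _] := PQ; have [//|+ _] := h p; rewrite ?finset.in_setT. Qed.

Let f_ge1 p : 1 <= f (P p).
Proof. by have [_ h _ _ _] := PQ; have [//|_] := h p; rewrite ?finset.in_setT. Qed.

Let Qf y p : `|(Q p *m y) 0 0| `^ s * f (P p) <= (3 * q) ^+ d * f y.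
Proof.
have [_ _ _ _ /(_ y p)] := PQ; rewrite cardsT card_ord; apply.
  by rewrite finset.in_setT.
by move=> j; rewrite finset.in_setT.
Qed.

Let coefM A B p r : coef (A *m B) p r = \sum_u coef A p u * coef B u r.
Proof.
rewrite /coef -mulmxA {1}[B *m P r]expand.
rewrite mulmx_sumr mulmx_sumr summxE; apply: eq_bigr => u _.
by rewrite -!scalemxAr mxE mulrC.
Qed.

Let coef_le B p r : `|coef B p r| <= 2 ^+ d * l1norm B.
Proof.
apply: Q_le => j; rewrite mxE.
apply: le_trans (ler_norm_sum _ _ _) (le_trans _ (l1norm_row_ge B j)).
by apply: ler_sum => i _; rewrite normrM ler_piMr.
Qed.

Let l1norm_coef B :
  l1norm B <= (d * d)%:R * 2 ^+ d * \sum_(pr : 'I_d * 'I_d) `|coef B pr.1 pr.2|.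
Proof.
set Z := \sum_pr _.
have BZ i j : `|B i j| <= 2 ^+ d * Z.
  have -> : B i j = \sum_p \sum_r
      (Q r *m (delta_mx j 0 : 'cV[R]_d)) 0 0 * coef B p r * P p i 0.
    transitivity ((B *m delta_mx j 0 : 'cV[R]_d) i 0).
      by rewrite -colE mxE.
    rewrite {1}[B *m delta_mx j 0]expand summxE; apply: eq_bigr => p _.
    rewrite mxE -mulr_suml; congr (_ * _).
    rewrite {1}[delta_mx j 0 in LHS]expand !mulmx_sumr summxE; apply: eq_bigr => r _.
    by rewrite -!scalemxAr mxE.
  rewrite pair_bigA/= /Z mulr_sumr.
  apply: le_trans (ler_norm_sum _ _ _) _; apply: ler_sum => -[p r] _ /=.
  rewrite !normrM -[leRHS]mulr1; apply: ler_pM => //.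
  rewrite ler_wpM2r// -[leRHS]mulr1; apply: Q_le => k.
  by rewrite mxE; case: andb; rewrite ?normr1 ?normr0.
rewrite /l1norm (le_trans (ler_sum _ (fun i _ => ler_sum _ (fun j _ => BZ i j))))//.
by rewrite !sumr_const card_ord -mulrnA -[leLHS]mulr_natl mulrA.
Qed.

Let T := wsum s L 1.
Let G : R := (2 ^+ d) `^ s.
Let D : R := d%:R `^ s * d%:R.
Let V : R := (3 * q) ^+ d * rho.

Let T_ge0 : 0 <= T. Proof. exact: wsum_ge0. Qed.
Let G_ge0 : 0 <= G. Proof. exact: powR_ge0. Qed.
Let D_ge0 : 0 <= D. Proof. by rewrite mulr_ge0 ?powR_ge0. Qed.
Let V_ge0 : 0 <= V.
Proof. by rewrite mulr_ge0 ?exprn_ge0 ?mulr_ge0 ?(le_trans _ q_ge1) ?(ltW rho_gt0). Qed.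
Let E_ge0 n p r : 0 <= E n p r.
Proof. by apply: sumr_ge0 => B _; exact: powR_ge0. Qed.

Let E1_le p r : E 1 p r <= G * T.
Proof.
rewrite /E /T /wsum !sum_products1 mulr_sumr; apply: ler_sum => A _.
rewrite -powRM ?exprn_ge0 ?l1norm_ge0//.
by apply: ler_powR_base (ltW s_gt0) _ (coef_le _ _ _).
Qed.

(** The gain: at a step along which [f] does not increase, the norms of the
    matrices are replaced by the rate [rho] at which [f] contracts. *)
Let E1_good p r : f (P r) <= f (P p) -> E 1 p r <= V.
Proof.
move=> frp; have fp0 : 0 < f (P p) by apply: lt_le_trans (f_ge1 p).
rewrite -(ler_pM2r fp0) /E sum_products1 mulr_suml.
apply: le_trans (ler_sum _ (fun A _ => Qf (A *m P r) p)) _.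
have q0 : 0 <= (3 * q) ^+ d.
  by rewrite exprn_ge0// mulr_ge0// (le_trans _ q_ge1).
rewrite -mulr_sumr /V -mulrA ler_wpM2l// (le_trans (f_contract _))//.
by rewrite ler_wpM2l// ltW.
Qed.

Let E_step n p r : E n.+1 p r <= d%:R `^ s * \sum_u E 1 p u * E n u r.
Proof.
rewrite {1}/E sum_productsS.
have -> : \sum_u E 1 p u * E n u r = \sum_(A <- L) \sum_(B <- products L n)
    \sum_u `|coef A p u| `^ s * `|coef B u r| `^ s.
  under [RHS]eq_bigr do rewrite exchange_big/=.
  rewrite exchange_big/=; apply: eq_bigr => u _.
  rewrite {1}/E sum_products1 mulr_suml; apply: eq_bigr => A _.
  by rewrite mulr_sumr.
rewrite mulr_sumr; apply: ler_sum => A _.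
rewrite mulr_sumr; apply: ler_sum => B _.
apply: (@le_trans _ _ ((\sum_u `|coef A p u| * `|coef B u r|) `^ s)).
  apply: ler_powR_base (ltW s_gt0) _ _ => //.
  rewrite coefM; apply: le_trans (ler_norm_sum _ _ _) _.
  by apply: ler_sum => u _; rewrite normrM.
under [in leRHS]eq_bigr do rewrite -powRM//.
by have := powR_sum_le s_gt0 (fun u => mulr_ge0 (normr_ge0 (coef A p u))
  (normr_ge0 (coef B u r))); rewrite card_ord.
Qed.

Let sum_const (x : R) : \sum_(u < d) x = d%:R * x.
Proof. by rewrite sumr_const card_ord mulr_natl. Qed.

(** The bound by the norms alone, whatever the path. *)
Let E_le n p r : E n p r <= (D * (G * T)) ^+ n * G.
Proof.
elim: n p => [|n IH] p.
  rewrite /E sum_products0 expr0 mul1r /coef mul1mx.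
  apply: ler_powR_base (ltW s_gt0) _ _ => //.
  by rewrite -[leRHS]mulr1; exact: Q_le.
apply: le_trans (E_step _ _ _) _.
have step u : E 1 p u * E n u r <= G * T * ((D * (G * T)) ^+ n * G).
  by apply: ler_pM.
apply: le_trans (ler_wpM2l (powR_ge0 _ _) (ler_sum _ (fun u _ => step u))) _.
by rewrite sum_const exprS /D !mulrA.
Qed.

(** Bounds the number of consecutive steps from [p] along which [f] strictly
    increases, because it decreases at each of them; it is less than [d]. *)
Let height p := #|[set r | f (P p) < f (P r)]%SET|.

(** By induction on the length, looking at the first step [p -> u]: if [f] does
    not increase along it, the factor [V] is obtained at once and the rest is
    bounded by norms; otherwise [height u < height p], and the factor comes
    from the remaining steps. *)
Let E_high n p r : (height p < n)%N ->
  E n p r <= D ^+ n * (G * T) ^+ n.-1 * V * G.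
Proof.
elim: n p => // n IH p; rewrite ltnS => hp /=.
apply: le_trans (E_step _ _ _) _.
have step u : E 1 p u * E n u r <= D ^+ n * (G * T) ^+ n * V * G.
  have [fup|fpu] := leP (f (P u)) (f (P p)).
    apply: le_trans (ler_pM _ _ (E1_good fup) (E_le n u r)) _ => //.
    by rewrite exprMn [leLHS]mulrA [V * _]mulrC.
  have hu : (height u < n)%N.
    apply: leq_trans hp; apply: proper_card; apply/properP; split.
      by apply/fintype.subsetP => w; rewrite !finset.inE; exact: lt_trans.
    by exists u; rewrite finset.inE// ltxx.
  apply: le_trans (ler_pM _ _ (E1_le p u) (IH u hu)) _ => //.
  case: n hu {IH hp} => // n _ /=.
  by rewrite [(G * T) ^+ n.+1]exprS; move: (G * T) => X; rewrite -!mulrA mulrCA.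
apply: le_trans (ler_wpM2l (powR_ge0 _ _) (ler_sum _ (fun u _ => step u))) _.
by rewrite sum_const exprS /D !mulrA.
Qed.

(** Heights are less than [d], so paths of length [d] always contain a step along
    which [f] does not increase; it remains to compare the norm with the sum of the
    entries in the adapted basis. *)
Lemma wsum_dim_le : (0 < d)%N ->
  wsum s L d <= ((d * d)%:R * 2 ^+ d) `^ s * (d * d)%:R `^ s * (d * d)%:R *
    (D ^+ d * (G * T) ^+ d.-1 * V * G).
Proof.
move=> d0.
have Ed p r : E d p r <= D ^+ d * (G * T) ^+ d.-1 * V * G.
  apply: E_high; rewrite -[ltnRHS]card_ord -cardsT; apply: proper_card.
  apply/properP; split; first exact: finset.subsetT.
  by exists p; rewrite ?finset.in_setT// finset.inE ltxx.
apply: (@le_trans _ _ (\sum_(B <- products L d) ((d * d)%:R * 2 ^+ d) `^ s *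
    (d * d)%:R `^ s * \sum_(pr : 'I_d * 'I_d) `|coef B pr.1 pr.2| `^ s)).
  apply: ler_sum => B _.
  apply: le_trans (ler_powR_base (ltW s_gt0) (l1norm_ge0 _) (l1norm_coef B)) _.
  set K := _ * 2 ^+ d; set Z := \sum_pr _.
  have K0 : 0 <= K by rewrite mulr_ge0// exprn_ge0.
  have Z0 : 0 <= Z by apply: sumr_ge0.
  rewrite (powRM _ K0 Z0) -[leRHS]mulrA; apply: ler_wpM2l; first exact: powR_ge0.
  have := powR_sum_le s_gt0 (fun pr : 'I_d * 'I_d => normr_ge0 (coef B pr.1 pr.2)).
  by rewrite card_prod !card_ord.
rewrite -mulr_sumr -[leRHS]mulrA; apply: ler_wpM2l.
  by rewrite mulr_ge0 ?powR_ge0.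
rewrite exchange_big/=.
apply: le_trans (ler_sum _ (fun pr _ => Ed pr.1 pr.2)) _.
by rewrite sumr_const card_prod !card_ord [leRHS]mulr_natl.
Qed.

End ProductBound.

(** * A lower bound for the growth rate *)

Section PressureInequality.
Context {R : realType} {d : nat}.
Implicit Types (L : seq 'M[R]_d) (s : R).

(** An explicit value is kept because its continuity in [s] is needed. *)
Definition rate_const s : R :=
  ((d * d)%:R * 2 ^+ d) `^ s * (d * d)%:R `^ s * (d * d)%:R *
  (d%:R `^ s * d%:R) ^+ d * ((2 ^+ d) `^ s) ^+ d * (3 * 2 `^ s) ^+ d.

Lemma rate_const_gt0 s : (0 < d)%N -> 0 < rate_const s.
Proof.
move=> d0; have dd : 0 < (d * d)%:R :> R by rewrite ltr0n muln_gt0 d0.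
by rewrite !(mulr_gt0, exprn_gt0, powR_gt0)// ltr0n.
Qed.

(** A counterpart, for sums of [s]-th powers, of the inequality of J. Bochi for
    the joint spectral radius; for sums it is due to I. D. Morris. *)
Lemma wsum_dim_le_rate s L rho n : (0 < d)%N -> 0 < s -> 0 < rho -> (0 < n)%N ->
  wsum s L n <= rho ^+ n ->
  wsum s L d <= rate_const s * rho * wsum s L 1 ^+ d.-1.
Proof.
move=> d0 s0 rho0 n0 Ln.
have q1 : 1 <= 2 `^ s :> R
  by rewrite -[leLHS](powRr0 (2 : R)) ler_powR ?ler1n// ltW.
have [P [Q PQ]] := adapted_coordinates s0 q1
  (orbit_weightD L n s0 rho0) (orbit_weightZ s rho L n)
  (orbit_weight_ge L s0 rho0 n0).
have := wsum_dim_le s0 q1 rho0 PQ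
  (fun x => orbit_weight_contract s0 rho0 x Ln) d0.
move=> /le_trans; apply.
rewrite /rate_const; set g := (2 ^+ d) `^ s.
have -> : g ^+ d = g ^+ d.-1 * g by rewrite -exprSr prednK.
rewrite [(g * _) ^+ _]exprMn.
by rewrite le_eqVlt; apply/orP; left; apply/eqP; ring.
Qed.

Lemma wsum_mul_le s L m n : 0 <= s -> (0 < n)%N ->
  wsum s L (m * n) <= wsum s L m ^+ n.
Proof.
move=> s0; elim: n => // -[|n] IH _; first by rewrite muln1 expr1.
rewrite mulnS exprS (le_trans (wsumD_le _ _ _ s0))//.
by rewrite ler_wpM2l ?wsum_ge0// IH.
Qed.

(** The previous inequality for the products of length [n].  Its hypothesis
    follows from the one at length [m], since
    [t_(m n) <= t_m^n <= (eta^n)^m] with [t = wsum s L]. *)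
Lemma wsum_block_le_rate s L eta m n : (0 < d)%N -> 0 < s -> 0 < eta ->
  (0 < m)%N -> (0 < n)%N -> wsum s L m <= eta ^+ m ->
  wsum s L (d * n) <= rate_const s * eta ^+ n * wsum s L n ^+ d.-1.
Proof.
move=> d0 s0 eta0 m0 n0 Lm; rewrite -wsumM.
apply: le_trans (wsum_dim_le_rate d0 s0 (exprn_gt0 n eta0) m0 _) _.
  rewrite wsumM -exprM [(n * m)%N]mulnC exprM.
  rewrite (le_trans (wsum_mul_le _ _ (ltW s0) n0))//.
  by rewrite lerXn2r// nnegrE ?wsum_ge0// exprn_ge0// ltW.
by rewrite wsumM mul1n.
Qed.

End PressureInequality.

(** * Growth rates of submultiplicative sequences *)

Section GrowthRate.
Context {R : realType}.
Implicit Types (t : nat -> R) (eta : R).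

Definition submul t := (forall n, 0 <= t n) /\ (forall m n, t (m + n)%N <= t m * t n).

Definition growth t : R := inf [set t n `^ n%:R^-1 | n in [set n | (0 < n)%N]].

Lemma root_exprK t n : (forall n, 0 <= t n) -> (0 < n)%N -> (t n `^ n%:R^-1) ^+ n = t n.
Proof.
move=> t0 n0; rewrite -powR_mulrn ?powR_ge0// -powRrM mulVf ?powRr1//.
by rewrite pnatr_eq0 -lt0n.
Qed.

Lemma growth_ge0 t : 0 <= growth t.
Proof.
apply: lb_le_inf; first by exists (t 1%N `^ 1%:R^-1), 1%N.
by move=> _ [n _ <-]; exact: powR_ge0.
Qed.

Lemma growth_le_root t n : (0 < n)%N -> growth t <= t n `^ n%:R^-1.
Proof.
move=> n0; apply: ge_inf; last by exists n.
by exists 0 => _ [k _ <-]; exact: powR_ge0.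
Qed.

Lemma growth_exp_le t n : (forall n, 0 <= t n) -> (0 < n)%N ->
  growth t ^+ n <= t n.
Proof.
move=> t0 n0; rewrite -[leRHS](root_exprK t0 n0).
by rewrite lerXn2r ?nnegrE ?growth_ge0 ?powR_ge0// growth_le_root.
Qed.

Lemma growth_le t n eta : (forall n, 0 <= t n) -> (0 < n)%N -> 0 <= eta ->
  t n <= eta ^+ n -> growth t <= eta.
Proof.
move=> t0 n0 eta0 tn; rewrite -(@ler_pXn2r R n)// ?nnegrE ?growth_ge0//.
by rewrite (le_trans _ tn)// growth_exp_le.
Qed.

Lemma growth_lt t eta : (forall n, 0 <= t n) -> growth t < eta ->
  exists2 n, (0 < n)%N & t n < eta ^+ n.
Proof.
move=> t0 /inf_lt[|_ [n n0 <-] tn].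
  by exists (t 1%N `^ 1%:R^-1), 1%N.
exists n => //; rewrite -(root_exprK t0 n0) ltrXn2r// ?powR_ge0//.
by rewrite -lt0n.
Qed.

(** Fekete: fix [m > 0] with [t_m < eta^m] and peel off blocks of length [m]. *)
Lemma submul_le_geometric t eta : submul t -> growth t < eta ->
  exists2 M, 0 < M & forall n, t n <= M * eta ^+ n.
Proof.
move=> [t0 tD] teta.
have eta0 : 0 < eta by apply: le_lt_trans teta; exact: growth_ge0.
have [m m0 tm] := growth_lt t0 teta.
have term_ge0 i : 0 <= t i / eta ^+ i by rewrite divr_ge0// exprn_ge0// ltW.
(* large enough to cover all lengths below [m] *)
exists (1 + \sum_(i < m) t i / eta ^+ i); first by rewrite ltr_wpDr// sumr_ge0.
move=> n; have [N] := ubnP n; elim: N n => // N IH n; rewrite ltnS => nN.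
have [nm|mn] := ltnP n m.
  rewrite -ler_pdivrMr ?exprn_gt0// (bigD1 (Ordinal nm))//=.
  by rewrite addrCA lerDl addr_ge0// sumr_ge0.
rewrite -(subnK mn) exprD mulrA (le_trans (tD _ _))//.
apply: ler_pM => //; last exact: ltW.
apply: IH; apply: leq_trans nN.
by rewrite ltn_subrL m0 (leq_trans m0 mn).
Qed.

Lemma cvg_root_cst (c : R) : 0 < c -> (c `^ n%:R^-1) @[n --> \oo] --> (1 : R).
Proof.
move=> c0.
have -> : (fun n : nat => c `^ n%:R^-1) = (fun n : nat => expR (n%:R^-1 * ln c)).
  by apply/funext => n; rewrite /powR gt_eqF.
rewrite -[X in _ --> X]expR0; apply: continuous_cvg; first exact: continuous_expR.
rewrite -[X in _ --> X](mul0r (ln c)); apply: cvgMr_tmp.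
have inv0 : (fun n => n%:R^-1 : R) @ \oo --> (0 : R).
  by rewrite -cvg_shiftS; exact: cvg_harmonic.
exact: inv0.
Qed.

Lemma cvg_root_growth t : submul t -> (t n `^ n%:R^-1) @[n --> \oo] --> growth t.
Proof.
move=> tS; have [t0 _] := tS; apply/cvgrPdist_le => e e0.
have [|M M0 tM] := @submul_le_geometric t (growth t + e / 2) tS.
  by rewrite ltrDl divr_gt0.
set eta := growth t + e / 2 in tM.
have eta0 : 0 <= eta by rewrite addr_ge0 ?growth_ge0// divr_ge0// ltW.
have lim : (M `^ n%:R^-1 * eta) @[n --> \oo] --> 1 * eta.
  exact: cvgMr_tmp (cvg_root_cst M0).
near=> n.
have n0 : (0 < n)%N by near: n; exact: nbhs_infty_gt.
rewrite distrC ger0_norm ?subr_ge0 ?growth_le_root// lerBlDl.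
apply: (@le_trans _ _ (M `^ n%:R^-1 * eta)).
  rewrite -[eta in leRHS]powRr1// -[X in eta `^ X](@mulfV _ n%:R) ?pnatr_eq0 -?lt0n//.
  rewrite powRrM powR_mulrn// -powRM ?exprn_ge0 ?(ltW M0)//.
  by apply: ler_powR_base; rewrite ?invr_ge0.
apply: ltW; near: n; apply: (cvgr_lt _ lim).
by rewrite mul1r /eta ltrD2l ltr_pdivrMr// ltr_pMr// ltr1n.
Unshelve. all: by end_near. Qed.

(** Upper semicontinuity: a single [n] with [t p0 n < eta ^+ n] works for all
    [p] near [p0].  For lower semicontinuity let [0 < eta < rho], where
    [rho = growth (t p0)]: for a suitable [n] the inequality of the last
    hypothesis fails at [p0] for this [eta], hence also near [p0], and there
    the growth rate cannot be less than [eta]. *)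
Lemma growth_continuous (T : topologicalType) (t : T -> nat -> R) (C : T -> R)
    (p0 : T) (d : nat) : (0 < d)%N ->
  (\forall p \near p0, submul (t p)) ->
  (forall n, t p n @[p --> p0] --> t p0 n) ->
  C p @[p --> p0] --> C p0 -> 0 < C p0 ->
  (\forall p \near p0, forall eta m n, 0 < eta -> (0 < m)%N -> (0 < n)%N ->
     t p m <= eta ^+ m ->
     t p (d * n)%N <= C p * eta ^+ n * t p n ^+ d.-1) ->
  growth (t p) @[p --> p0] --> growth (t p0).
Proof.
move=> d0 tS tc Cc C0 tC.
have tS0 := nbhs_singleton tS; have [t00 _] := tS0.
have upper eta : growth (t p0) < eta -> \forall p \near p0, growth (t p) <= eta.
  move=> teta; have [n n0 tn] := growth_lt t00 teta.
  have eta0 : 0 <= eta by rewrite ltW// (le_lt_trans _ teta)// growth_ge0.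
  near=> p; have [t0 _] : submul (t p) by near: p.
  apply: (growth_le t0 n0 eta0); apply: ltW; near: p.
  exact: (cvgr_lt _ (tc n)).
have lower eta : eta < growth (t p0) -> \forall p \near p0, eta <= growth (t p).
  move=> teta; have [eta0|eta0] := leP eta 0.
    by apply: nearW => p; rewrite (le_trans eta0)// growth_ge0.
  set rho := growth (t p0) in teta.
  have rho0 : 0 < rho by exact: lt_trans teta.
  (* chosen so that [eta * (rho * lam)^(d-1) = rho^d / lam]: as
     [t_n = O((rho * lam)^n)], the right-hand side of the inequality is then
     [O(rho^(d n) / lam^n)], less than [rho^(d n) <= t_(d n)] for large [n] *)
  pose lam := (rho / eta) `^ d%:R^-1.
  have lamd : lam ^+ d = rho / eta.
    rewrite /lam -powR_mulrn ?powR_ge0// -powRrM mulVf ?powRr1//.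
      by rewrite divr_ge0// ltW.
    by rewrite pnatr_eq0 -lt0n.
  have lam_gt1 : 1 < lam.
    rewrite ltNge; apply/negP => lam1.
    have : lam ^+ d <= 1 by rewrite exprn_ile1// powR_ge0.
    by rewrite lamd ler_pdivrMr// mul1r leNgt teta.
  have lam0 : 0 < lam by exact: lt_trans lam_gt1.
  have [|M M0 tM] := @submul_le_geometric (t p0) (rho * lam) tS0.
    by rewrite -/rho ltr_pMr.
  have geo : (C p0 * M ^+ d.-1 * lam^-1 ^+ n) @[n --> \oo] --> C p0 * M ^+ d.-1 * 0.
    apply: cvgMl_tmp; apply: cvg_expr.
    by rewrite ger0_norm ?invr_ge0 ?(ltW lam0)// invf_lt1.
  have [n [n0 gn]] : exists n, (0 < n)%N /\ C p0 * M ^+ d.-1 * lam^-1 ^+ n < 1.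
    have : \forall n \near \oo, (0 < n)%N /\ C p0 * M ^+ d.-1 * lam^-1 ^+ n < 1.
      near=> n; split; near: n; first exact: nbhs_infty_gt.
      by apply: (cvgr_lt _ geo); rewrite mulr0.
    by move=> /filter_ex.
  have key : C p0 * eta ^+ n * t p0 n ^+ d.-1 < t p0 (d * n)%N.
    apply: (@le_lt_trans _ _ (C p0 * eta ^+ n * (M * (rho * lam) ^+ n) ^+ d.-1)).
      rewrite ler_wpM2l ?mulr_ge0 ?exprn_ge0 ?(ltW C0) ?(ltW eta0)//.
      by rewrite lerXn2r ?nnegrE ?mulr_ge0 ?exprn_ge0 ?mulr_ge0
        ?(ltW M0) ?(ltW rho0) ?(ltW lam0).
    apply: (@lt_le_trans _ _ (rho ^+ (d * n))); last first.
      by rewrite growth_exp_le// muln_gt0 d0.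
    have -> : C p0 * eta ^+ n * (M * (rho * lam) ^+ n) ^+ d.-1 =
        C p0 * M ^+ d.-1 * lam^-1 ^+ n * rho ^+ (d * n).
      have -> : rho ^+ (d * n) = (eta * rho ^+ d.-1 * lam ^+ d.-1 * lam) ^+ n.
        rewrite exprM; congr (_ ^+ n); rewrite -mulrA -exprSr prednK// lamd.
        rewrite -[d in LHS](prednK d0) exprS; field; exact: lt0r_neq0.
      rewrite !exprMn -!exprM ![(n * _)%N]mulnC exprVn.
      have lamn : lam ^+ n != 0 by rewrite expf_neq0// gt_eqF.
      by field.
    by rewrite gtr_pMl// exprn_gt0.
  (* both sides are continuous at [p0] and the inequality is strict *)
  have near_key : \forall p \near p0, C p * eta ^+ n * t p n ^+ d.-1 < t p (d * n)%N.
    have cl : (C p * eta ^+ n * t p n ^+ d.-1) @[p --> p0] -->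
        C p0 * eta ^+ n * t p0 n ^+ d.-1.
      apply: cvgM; first exact: cvgMr_tmp.
      have xc : {for t p0 n, continuous (fun x : R => x ^+ d.-1)}.
        exact: exprn_continuous.
      exact: (continuous_cvg _ xc (tc n)).
    have [mid [m1 m2]] : exists mid,
        C p0 * eta ^+ n * t p0 n ^+ d.-1 < mid /\ mid < t p0 (d * n)%N.
      by have [m1 m2] := midf_lt key; eexists; split; [exact: m1|exact: m2].
    near=> p; apply: (@lt_trans _ _ mid); near: p.
      exact: (cvgr_lt _ cl).
    exact: (cvgr_gt _ (tc _)).
  near=> p; rewrite leNgt; apply/negP => tp.
  have [t0 _] : submul (t p) by near: p.
  have [m m0 tm] := growth_lt t0 tp.
  have : C p * eta ^+ n * t p n ^+ d.-1 < t p (d * n)%N by near: p.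
  rewrite ltNge => /negP; apply.
  have : forall eta m n, 0 < eta -> (0 < m)%N -> (0 < n)%N ->
     t p m <= eta ^+ m ->
     t p (d * n)%N <= C p * eta ^+ n * t p n ^+ d.-1 by near: p.
  by move=> /(_ eta m n eta0 m0 n0 (ltW tm)).
apply/cvgrPdist_le => e e0; near=> p; rewrite ler_distlC; apply/andP; split.
  by near: p; apply: lower; rewrite ltrBlDr ltrDl.
by near: p; apply: upper; rewrite ltrDl.
Unshelve. all: by end_near. Qed.

End GrowthRate.

(** * Comparison with the Euclidean operator norm *)

Section OperatorNorm.
Context {R : realType} {d : nat}.
Implicit Types (B : 'M[R]_d) (x : 'cV[R]_d).

Lemma entry_le_enorm x i : `|x i 0| <= enorm x.
Proof.
rewrite -sqrtr_sqr; apply: ler_wsqrtr.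
by rewrite (bigD1 i)//= lerDl sumr_ge0// => j _; exact: sqr_ge0.
Qed.

Lemma enorm_le_l1norm x : enorm x <= l1norm x.
Proof.
rewrite -[leRHS]ger0_norm ?l1norm_ge0// -sqrtr_sqr; apply: ler_wsqrtr.
rewrite expr2 {1}/l1norm mulr_suml; apply: ler_sum => i _.
rewrite big_ord1 -[x i 0 ^+ 2]real_normK ?num_real// expr2.
by rewrite ler_wpM2l// l1norm_entry_ge.
Qed.

Lemma enorm_mulmx_le B x : enorm x <= 1 -> enorm (B *m x) <= l1norm B.
Proof.
move=> x1; apply: le_trans (enorm_le_l1norm _) _; apply: ler_sum => i _.
rewrite big_ord1 mxE (le_trans (ler_norm_sum _ _ _))//; apply: ler_sum => j _.
by rewrite normrM ler_piMr// (le_trans (entry_le_enorm x j)).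
Qed.

Lemma opnorm_le_l1norm B : opnorm B <= l1norm B.
Proof.
apply: ge_sup.
  exists (enorm (B *m (0 : 'cV[R]_d))), 0 => //=.
  by rewrite /enorm big1 ?sqrtr0// => i _; rewrite mxE expr0n.
by move=> _ [x x1 <-]; exact: enorm_mulmx_le.
Qed.

(** A column of [B] is the image of a unit vector. *)
Lemma entry_le_opnorm B i j : `|B i j| <= opnorm B.
Proof.
have -> : B i j = (B *m delta_mx j 0 : 'cV[R]_d) i 0 by rewrite -colE mxE.
apply: le_trans (entry_le_enorm _ _) _; apply: ub_le_sup.
  by exists (l1norm B) => _ [x x1 <-]; exact: enorm_mulmx_le.
exists (delta_mx j 0) => //=.
rewrite /enorm (bigD1 j)//= mxE !eqxx expr1n big1 ?addr0 ?sqrtr1// => k kj.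
by rewrite mxE (negPf kj) expr0n.
Qed.

Lemma opnorm_ge0 B : 0 <= opnorm B.
Proof.
apply: (@le_trans _ _ (enorm (B *m (0 : 'cV[R]_d)))); first exact: sqrtr_ge0.
apply: ub_le_sup; first by exists (l1norm B) => _ [x x1 <-]; exact: enorm_mulmx_le.
by exists 0 => //=; rewrite /enorm big1 ?sqrtr0// => i _; rewrite mxE expr0n.
Qed.

Lemma l1norm_le_opnorm B : l1norm B <= (d * d)%:R * opnorm B.
Proof.
apply: le_trans (ler_sum _ (fun i _ => ler_sum _ (fun j _ => entry_le_opnorm B i j))) _.
by rewrite !sumr_const card_ord -mulrnA [leRHS]mulr_natl.
Qed.

End OperatorNorm.

(** * Sums over words *)

Section Words.
Context {R : realType} {d k : nat}.
Implicit Types (A : mxtuple R d k) (s : R).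

Definition letters A : seq 'M[R]_d := [seq A i | i <- enum 'I_k].

Lemma sum_words A n (phi : 'M[R]_d -> R) :
  \sum_(w : n.-tuple 'I_k) phi (word_mx A w) =
  \sum_(B <- products (letters A) n) phi B.
Proof.
elim: n phi => [|n IH] phi.
  rewrite sum_products0 (bigD1 [tuple])//= big1 ?addr0; last first.
    by move=> w /eqP[]; exact: tuple0.
  by rewrite /word_mx big_nil.
rewrite sum_productsS big_map big_enum/=.
rewrite (reindex (fun p : 'I_k * n.-tuple 'I_k => [tuple of p.1 :: p.2]))/=; last first.
  exists (fun w => (thead w, [tuple of behead w])) => [[i w] _|w _] /=.
    by rewrite theadE; congr (_, _); exact: val_inj.
  by rewrite -tuple_eta.
rewrite -(pair_bigA _ (fun i w => phi (word_mx A (i :: tval w))))/=.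
apply: eq_bigr => i _; rewrite -IH; apply: eq_bigr => w _.
by rewrite /word_mx big_cons.
Qed.

Definition wordsum A s := wsum s (letters A).

Lemma word_sum_le A s n : 0 < s -> word_sum A s n <= wordsum A s n.
Proof.
move=> s0; rewrite /word_sum (sum_words A n (fun B => opnorm B `^ s)).
apply: ler_sum => B _.
exact: ler_powR_base (ltW s0) (opnorm_ge0 _) (opnorm_le_l1norm _).
Qed.

Lemma wordsum_le A s n : 0 < s ->
  wordsum A s n <= (d * d)%:R `^ s * word_sum A s n.
Proof.
move=> s0; rewrite /word_sum (sum_words A n (fun B => opnorm B `^ s)) mulr_sumr.
apply: ler_sum => B _.
rewrite -powRM ?opnorm_ge0//.
exact: ler_powR_base (ltW s0) (l1norm_ge0 _) (l1norm_le_opnorm _).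
Qed.

Lemma wordsum_submul A s : 0 < s -> submul (wordsum A s).
Proof.
by move=> s0; split=> *; [exact: wsum_ge0|exact/wsumD_le/ltW].
Qed.

End Words.

(** * Limits of powers and logarithms *)

Section Limits.
Context {R : realType}.

(** Includes the case of the limit [-oo], reached when [l] vanishes. *)
Lemma cvg_lne (T : Type) (F : set_system T) {FF : Filter F} (g : T -> R) (l : R) :
  g x @[x --> F] --> l -> lne (g x)%:E @[x --> F] --> lne l%:E.
Proof.
move=> gl; have [l0|l0] := ltP 0 l.
  rewrite lne_EFin//; apply: (@cvg_trans _ ((ln (g x))%:E @[x --> F])).
    apply: near_eq_cvg; near=> x; rewrite lne_EFin//; near: x.
    exact: (cvgr_gt _ gl).
  apply: cvg_EFin; first exact: nearW.
  exact: (continuous_cvg _ (continuous_ln l0) gl).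
rewrite le0_lneNy ?lee_fin//; apply/cvgeNyPle => a.
near=> x; have [gx0|gx0] := leP (g x) 0; first by rewrite le0_lneNy ?lee_fin ?leNye.
rewrite lne_EFin// lee_fin -(expRK a) ler_ln ?posrE ?expR_gt0//; apply: ltW.
by near: x; apply: (cvgr_lt _ gl); rewrite (le_lt_trans l0)// expR_gt0.
Unshelve. all: by end_near. Qed.

(** Joint continuity of [x `^ y] for [0 <= x] and [0 < y].  The case [a = 0] is
    the one needing care: there [f x `^ g x <= f x `^ (b / 2)] eventually, and
    the exponent is fixed. *)
Lemma cvg_powR (T : Type) (F : set_system T) {FF : Filter F} (f g : T -> R) (a b : R) :
  (forall x, 0 <= f x) -> 0 <= a -> 0 < b ->
  f x @[x --> F] --> a -> g x @[x --> F] --> b ->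
  f x `^ g x @[x --> F] --> a `^ b.
Proof.
move=> f0 a0 b0 fa gb; have [{}a0|a0'] := ltP 0 a.
  rewrite {2}/powR gt_eqF//.
  apply: (@cvg_trans _ (expR (g x * ln (f x)) @[x --> F])).
    apply: near_eq_cvg; near=> x; rewrite /powR gt_eqF//; near: x.
    exact: (cvgr_gt _ fa).
  apply: continuous_cvg; first exact: continuous_expR.
  by apply: cvgM => //; exact: (continuous_cvg _ (continuous_ln a0) fa).
have {a0 a0'} a0 : a = 0 by apply/eqP; rewrite eq_le a0 a0'.
rewrite {}a0 in fa *; rewrite powR0 ?gt_eqF//.
apply/cvgr0Pnorm_le => e e0; near=> x.
have hb : 0 < b / 2 by rewrite divr_gt0.
have gx : b / 2 <= g x.
  apply: ltW; near: x; apply: (cvgr_gt _ gb).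
  by rewrite ltr_pdivrMr// ltr_pMr// ltr1n.
have fx1 : f x <= 1 by apply: ltW; near: x; exact: (cvgr_lt _ fa).
have fxe : f x <= e `^ (b / 2)^-1.
  by apply: ltW; near: x; apply: (cvgr_lt _ fa); exact: powR_gt0.
rewrite ger0_norm ?powR_ge0//; have := f0 x.
rewrite le_eqVlt => /predU1P[<-|fx0].
  by rewrite powR0 ?ltW// gt_eqF// (lt_le_trans hb).
apply: (@le_trans _ _ (f x `^ (b / 2))); first by apply: ger_powR; rewrite ?fx0.
apply: (le_trans (ler_powR_base (ltW hb) (f0 x) fxe)).
by rewrite -powRrM mulVf ?gt_eqF// powRr1// ltW.
Unshelve. all: by end_near. Qed.

Lemma cvg_sumr (T : Type) (F : set_system T) {FF : Filter F} (I : Type) (r : seq I)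
    (f : I -> T -> R) (l : I -> R) :
  (forall i, f i x @[x --> F] --> l i) ->
  \sum_(i <- r) f i x @[x --> F] --> \sum_(i <- r) l i.
Proof. by move=> fl; apply: cvg_big => //; exact: add_continuous. Qed.

End Limits.

(** * Continuity of the pressure *)

Section Pressure.
Context {R : realType} {d k : nat}.
Implicit Types (A : mxtuple R d k) (s : R) (p : mxtuple R d k * R).

(** The roots of the sums of operator norms and of l1 norms differ by a factor
    between [c ^ (- 1 / n)] and 1, hence have the same limit; [lne] carries it
    over, including when it is 0. *)
Lemma pressure_seq_cvg A s : (0 < d)%N -> 0 < s ->
  pressure_seq A s @ \oo --> lne (growth (wordsum A s))%:E.
Proof.
move=> d0 s0; set c : R := (d * d)%:R `^ s.
have c0 : 0 < c by rewrite powR_gt0// ltr0n muln_gt0 d0.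
have tS := wordsum_submul A s0.
have S0 n : 0 <= word_sum A s n by apply: sumr_ge0 => w _; exact: powR_ge0.
have root : (word_sum A s n `^ n%:R^-1) @[n --> \oo] --> growth (wordsum A s).
  have low : ((c^-1 `^ n%:R^-1) * wordsum A s n `^ n%:R^-1) @[n --> \oo] -->
      1 * growth (wordsum A s).
    by apply: cvgM; [apply: cvg_root_cst; rewrite invr_gt0|exact: cvg_root_growth].
  rewrite mul1r in low; apply: squeeze_cvgr low (cvg_root_growth tS).
  apply: nearW => n; apply/andP; split.
    rewrite -powRM ?invr_ge0 ?(ltW c0) ?(proj1 tS)//.
    apply: ler_powR_base; rewrite ?invr_ge0// ?mulr_ge0 ?invr_ge0 ?(ltW c0) ?(proj1 tS)//.
    by rewrite mulrC ler_pdivrMr// mulrC wordsum_le.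
  by apply: ler_powR_base; rewrite ?invr_ge0// word_sum_le.
apply: cvg_trans (cvg_lne root); apply: near_eq_cvg; near=> n.
have n0 : (0 < n)%N by near: n; exact: nbhs_infty_gt.
have ninv : 0 < n%:R^-1 :> R by rewrite invr_gt0 ltr0n.
rewrite /pressure_seq; have := S0 n; rewrite le_eqVlt => /predU1P[<-|Sn].
  by rewrite powR0 ?gt_eqF// le0_lneNy// gt0_muleNy// lte_fin.
by rewrite !lne_EFin ?powR_gt0// ln_powR EFinM.
Unshelve. all: by end_near. Qed.

Lemma pressureE A s : (0 < d)%N -> 0 < s ->
  pressure A s = lne (growth (wordsum A s))%:E.
Proof. by move=> d0 s0; apply/cvg_lim => //; exact: pressure_seq_cvg. Qed.

Lemma letter_entry_cvg p0 l (i j : 'I_d) :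
  (p.1 : mxtuple R d k) l i j @[p --> p0] --> (p0.1 : mxtuple R d k) l i j.
Proof.
have fst0 : p.1 @[p --> p0] --> p0.1 by exact: cvg_fst.
have proj0 := cvg_comp _ _ fst0 (@proj_continuous _ (fun _ : 'I_k => 'M[R]_d) l p0.1).
exact: cvg_comp _ _ proj0 (@coord_continuous _ _ _ i j _).
Qed.

Lemma word_entry_cvg p0 w (i j : 'I_d) :
  word_mx p.1 w i j @[p --> p0] --> word_mx p0.1 w i j.
Proof.
elim: w i j => [|l w IH] i j.
  rewrite /word_mx; under eq_cvg do rewrite big_nil.
  by rewrite big_nil; exact: cvg_cst.
have E p : word_mx p.1 (l :: w) i j = \sum_u p.1 l i u * word_mx p.1 w u j.
  by rewrite /word_mx big_cons mxE.
rewrite E; under eq_cvg do rewrite E.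
by apply: cvg_sumr => u; apply: cvgM; [exact: letter_entry_cvg|exact: IH].
Qed.

Lemma wordsum_cvg p0 n : 0 < p0.2 ->
  wordsum p.1 p.2 n @[p --> p0] --> wordsum p0.1 p0.2 n.
Proof.
move=> s0.
have E p : wordsum p.1 p.2 n =
    \sum_(w : n.-tuple 'I_k) l1norm (word_mx p.1 w) `^ p.2.
  by rewrite (sum_words p.1 n (fun B => l1norm B `^ p.2)).
rewrite E; under eq_cvg do rewrite E.
apply: cvg_sumr => w; apply: cvg_powR => //.
- by move=> p; exact: l1norm_ge0.
- exact: l1norm_ge0.
- apply: cvg_sumr => i; apply: cvg_sumr => j.
  by apply: cvg_norm; exact: word_entry_cvg.
- exact: cvg_snd.
Qed.

Lemma rate_const_cvg s0 : 0 < s0 -> @rate_const R d s @[s --> s0] -->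
  (@rate_const R d s0 : R).
Proof.
move=> s00.
have pc (a : R) : 0 <= a -> (a `^ s) @[s --> s0] --> a `^ s0.
  by move=> a0; apply: cvg_powR => //; exact: cvg_cst.
have ec (f : R -> R) n : f s @[s --> s0] --> f s0 -> (f s ^+ n) @[s --> s0] --> f s0 ^+ n.
  move=> fc; have xc : {for f s0, continuous (fun x : R => x ^+ n)}.
    exact: exprn_continuous.
  exact: (continuous_cvg _ xc fc).
have pc2 : ((2 : R) `^ s) @[s --> s0] --> (2 : R) `^ s0 by exact: pc.
apply: cvgM; last by apply: (ec (fun s => 3 * 2 `^ s)); exact: cvgMl_tmp.
apply: cvgM; last by apply: (ec (fun s => (2 ^+ d) `^ s)); apply: pc; exact: exprn_ge0.
apply: cvgM; last first.
  by apply: (ec (fun s => d%:R `^ s * d%:R)); apply: cvgMr_tmp; exact: pc.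
apply: cvgMr_tmp; apply: cvgM; last exact: pc.
by apply: pc; rewrite mulr_ge0// exprn_ge0.
Qed.

Lemma pressure_continuous_at p0 : (0 < d)%N -> 0 < p0.2 ->
  pressure p.1 p.2 @[p --> p0] --> pressure p0.1 p0.2.
Proof.
move=> d0 s0.
have snd0 : p.2 @[p --> p0] --> p0.2 by exact: cvg_snd.
have pos : \forall p \near p0, 0 < p.2 by exact: (cvgr_gt _ snd0).
have rate : growth (wordsum p.1 p.2) @[p --> p0] --> growth (wordsum p0.1 p0.2).
  apply: (@growth_continuous R _ (fun p => wordsum p.1 p.2)
    (fun p => @rate_const R d p.2) p0 d d0).
  - by apply: filterS pos => p; exact: wordsum_submul.
  - by move=> n; exact: wordsum_cvg.
  - exact: cvg_comp _ _ snd0 (rate_const_cvg s0).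
  - exact: rate_const_gt0.
  - by apply: filterS pos => p sp eta m n *; exact: (wsum_block_le_rate (m := m)).
rewrite pressureE//; apply: cvg_trans (cvg_lne rate).
by apply: near_eq_cvg; apply: filterS pos => p sp; rewrite pressureE.
Qed.

End Pressure.

Theorem theorem1p3 (R : realType) (d k : nat) (hd : (1 <= d)%N) (hk : (2 <= k)%N) :
  (forall (A : mxtuple R d k) (s : R), 0 < s ->
     pressure_seq A s @ \oo --> pressure A s /\ (pressure A s < +oo)%E) /\
  {within [set p : mxtuple R d k * R | 0 < p.2],
    continuous (fun p : mxtuple R d k * R => pressure p.1 p.2)}.
Proof.
split.
  move=> A s s0; rewrite pressureE//; split; first exact: pressure_seq_cvg.
  have [g0|g0] := leP (growth (wordsum A s)) 0; first by rewrite le0_lneNy.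
  by rewrite lne_EFin// ltry.
rewrite continuous_open_subspace => [p|].
  by rewrite inE => p0; exact: pressure_continuous_at.
rewrite (_ : [set p | _] = @snd _ R @^-1` [set s | 0 < s])//.
by apply: open_comp; [move=> p _; exact: cvg_snd|exact: open_gt].
Qed.
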